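(* There exists an online algorithm for $\textsc{Online-Sorting}[1,n]$ with competitive ratio at most $18\sqrt{n}$ (i.e., its cost is at most $18\sqrt n$ on every stream of $n$ reals in $[0,1]$). Moreover, every online algorithm for $\textsc{Online-Sorting}[1,n]$ has competitive ratio at least $\sqrt{n/2}$ (i.e., for every online algorithm there is an adaptively chosen stream of $n$ reals in $[0,1]$ on which its cost is at least $\sqrt{n/2}$).
   Context: $\textsc{Online-Sorting}[\gamma,n]$ (for $\gamma\ge 1$): there is an array $A$ consisting of $\gamma n$ initially empty cells, ordered from left to right. A stream of $n$ reals $s_1,\dots,s_n\in[0,1]$ arrives one at a time (the stream may be chosen adaptively by an adversary). An online algorithm must place each $s_i$ into an empty cell of $A$, irrevocably, before $s_{i+1}$ is revealed. After all reals are placed, let $r_1,\dots,r_n$ be the reals in left-to-right order in $A$, with $r_0:=0$, $r_{n+1}:=1$; the cost is $\sum_{i=0}^{n}|r_{i+1}-r_i|$. The offline optimum has cost exactly $1$, so an algorithm has competitive ratio $\Delta$ if its cost is at most $\Delta$ on every stream of $n$ reals. For $\gamma=1$ the array has exactly $n$ cells. *)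

(* Defs.v *)
From mathcomp Require Import all_boot all_order all_algebra.
From mathcomp Require Import reals.
Set Implicit Arguments. Unset Strict Implicit. Unset Printing Implicit Defensive.
Import Order.TTheory GRing.Theory Num.Theory.
Local Open Scope ring_scope.

(* A deterministic online algorithm for Online-Sorting[1,n]: given the reals
   already received (in arrival order) and the newly arrived real, it returns
   the (0-based) index of the cell into which the new real is placed.  Since
   the algorithm is deterministic, the positions of all earlier reals are
   determined by the earlier prefix, so this captures all information an
   online algorithm has. *)
Definition online_alg (R : realType) := seq R -> R -> nat.

Definition in01 (R : realType) (x : R) : bool := (0 <= x) && (x <= 1).

Definition placements (R : realType) (alg : online_alg R) (s : seq R) : seq nat :=
  [seq alg (take i s) (nth 0 s i) | i <- iota 0 (size s)].

Definition valid_alg (R : realType) (n : nat) (alg : online_alg R) : Prop :=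
  forall (pre : seq R) (x : R),
    (size pre < n)%N -> all (@in01 R) pre -> in01 x ->
    (alg pre x < n)%N /\ alg pre x \notin placements alg pre.

Definition cell (R : realType) (alg : online_alg R) (s : seq R) (j : nat) : R :=
  nth 0 s (index j (placements alg s)).

Definition final_seq (R : realType) (n : nat) (alg : online_alg R) (s : seq R)
  : seq R := 0 :: rcons [seq cell alg s j | j <- iota 0 n] 1.

Definition cost (R : realType) (n : nat) (alg : online_alg R) (s : seq R) : R :=
  let r := final_seq n alg s in
  \sum_(i < n.+1) `|r`_(i.+1) - r`_i|.

Definition stream (R : realType) (n : nat) (s : seq R) : Prop :=
  size s = n /\ all (@in01 R) s.

(* Main.v *)
Require Import Defs.
From mathcomp Require Import all_boot all_order all_algebra.
From mathcomp Require Import reals boolp lra zify.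
Import Order.TTheory GRing.Theory Num.Theory.
Local Open Scope ring_scope.
Set Implicit Arguments. Unset Strict Implicit. Unset Printing Implicit Defensive.
(* Upper bound: split the [r] free cells, regarded as contiguous, into blocks of
   [h ~ sqrt r / 2] cells and [0, 1] into intervals of length [1 / h].  A block
   is reserved for the interval of the first real placed in it, and is filled
   from left to right; each interval has at most one partially filled block.
   This varies by O(sqrt r) and gets stuck only when every block is in use, so
   with at most [h] partially filled blocks and [h * h <= r / 4] free cells.
   Then restart on the free cells: interleaving the two arrays adds at most 2
   for each of the at most [h] runs of free cells, and the costs form a
   geometric series.

   Lower bound: let [d] be the integer part of [sqrt (2 n)], and put sentinels 0
   and 1 at the ends of the array.  Present multiples of [1 / d] that are not
   next to an empty cell: if this lasts for [n] steps, no two neighbours are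
   equal and the cost is at least [(n + 1) / d].  Otherwise every multiple of
   [1 / d] is next to an empty cell; then present only 0, at a cost of at least
   [0 + 1 / d + ... + d / d = (d + 1) / 2]. *)

(** * Placements and contents of the cells *)

Lemma placements_rcons (R : realType) (alg : online_alg R) (s : seq R) (x : R) :
  placements alg (rcons s x) = rcons (placements alg s) (alg s x).
Proof.
rewrite /placements size_rcons -addn1 iotaD add0n map_cat /= cats1.
rewrite -(cats1 s x) take_size_cat // nth_cat ltnn subnn /=.
congr rcons; apply/eq_in_map => i; rewrite mem_iota add0n /= => ltis.
by rewrite nth_cat ltis takel_cat // ltnW.
Qed.

Lemma size_placements (R : realType) (alg : online_alg R) (s : seq R) :
  size (placements alg s) = size s.
Proof. by rewrite size_map size_iota. Qed.

(** [cell] returns the default 0 on an empty cell; the option tells an empty cell from one that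
    holds 0. *)
Definition content {R : realType} (alg : online_alg R) (s : seq R) (j : nat) :
  option R := if j \in placements alg s then Some (cell alg s j) else None.

Lemma content_rcons (R : realType) (alg : online_alg R) (s : seq R) (x : R) j :
  alg s x \notin placements alg s ->
  content alg (rcons s x) j = if j == alg s x then Some x else content alg s j.
Proof.
move=> fresh; rewrite /content /cell placements_rcons mem_rcons inE -(cats1 (placements _ _)).
rewrite index_cat; have [->|neq] := eqVneq j (alg s x).
  by rewrite (negPf fresh) /= eqxx addn0 size_placements nth_rcons ltnn eqxx.
rewrite /=; case: ifP => // jp.
by rewrite nth_rcons jp -(size_placements alg s) index_mem jp.
Qed.

Lemma valid_placements (R : realType) n (alg : online_alg R) (s : seq R) :
  valid_alg n alg -> (size s <= n)%N -> all (@in01 R) s ->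
  uniq (placements alg s) /\ {subset placements alg s <= iota 0 n}.
Proof.
move=> valg; elim/last_ind: s => [|s x IHs] //.
rewrite size_rcons all_rcons => ltsn /andP[x01 s01].
have [us ss] := IHs (ltnW ltsn) s01.
have [ltn fresh] := valg s x ltsn s01 x01.
rewrite placements_rcons rcons_uniq fresh us; split=> // j.
by rewrite mem_rcons inE => /predU1P[->|/ss //]; rewrite mem_iota.
Qed.

Lemma full_placements {R : realType} {n} {alg : online_alg R} {s : seq R} {j} :
  valid_alg n alg -> stream n s -> (j < n)%N -> j \in placements alg s.
Proof.
move=> valg [ssz s01] ltjn; have [|us ss] := valid_placements valg _ s01.
  by rewrite ssz.
have [|_ ->] := uniq_min_size us ss; last by rewrite mem_iota.
by rewrite size_iota size_placements ssz.
Qed.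

(* The array with its two sentinels; cell [j] has index [j.+1]. *)
Definition bordered {R : realType} n (alg : online_alg R) (s : seq R) (i : nat) :
  option R :=
  if i is j.+1 then if j == n then Some 1 else content alg s j else Some 0.

Lemma bordered_rcons (R : realType) n (alg : online_alg R) (s : seq R) (x : R) i :
  (alg s x < n)%N -> alg s x \notin placements alg s ->
  bordered n alg (rcons s x) i =
    if i == (alg s x).+1 then Some x else bordered n alg s i.
Proof.
move=> lt fresh; case: i => [|j] //=; rewrite content_rcons // eqSS.
by have [->|//] := eqVneq j n; rewrite eq_sym (ltn_eqF lt).
Qed.

Lemma nth_final_seq {R : realType} {n} {alg : online_alg R} {s : seq R} {i} :
  valid_alg n alg -> stream n s -> (i <= n.+1)%N ->
  bordered n alg s i = Some (final_seq n alg s)`_i.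
Proof.
move=> valg strm; case: i => [|j] //=; rewrite ltnS => lejn.
rewrite nth_rcons size_map size_iota /content.
have [->|neq] := eqVneq j n; first by rewrite ltnn.
have ltjn : (j < n)%N by rewrite ltn_neqAle neq.
by rewrite (full_placements valg strm ltjn) ltjn (nth_map 0%N)
  ?size_iota // nth_iota.
Qed.

(** * Lower bound: the adversary *)

Definition exposed {R : realType} (E : nat -> option R) (v : R) (i : nat) : bool :=
  ((E i == Some v) && (E i.+1 == None)) || ((E i == None) && (E i.+1 == Some v)).

(** Such a pair of neighbours has only one filled end. Hence distinct grid values are exposed at
    distinct indices, and [cost_exposed] can add up their costs. *)
Lemma exposed_inj (R : realType) (E : nat -> option R) (v w : R) i :
  exposed E v i -> exposed E w i -> v = w.
Proof.
rewrite /exposed; case: (E i) (E i.+1) => [a|] [b|] //=; rewrite ?andbF ?andbT ?orbF //;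
  by move=> /eqP[<-] /eqP[<-].
Qed.

Section LowerBound.
Variables (R : realType) (n : nat) (alg : online_alg R).
Hypothesis valg : valid_alg n alg.
Variable d : nat.
Hypothesis d_gt0 : (0 < d)%N.

Local Notation E := (bordered n alg).
Local Notation grid v := (v%:R / d%:R : R).
Local Notation edge s i := `|(final_seq n alg s)`_(i.+1) - (final_seq n alg s)`_i|.

Lemma grid01 v : (v <= d)%N -> in01 (grid v).
Proof.
move=> lvd; rewrite /in01 divr_ge0 ?ler0n //=.
by rewrite ler_pdivrMr ?ltr0n // mul1r ler_nat.
Qed.

Definition spread (s : seq R) : Prop :=
  (forall i a, E s i = Some a -> exists2 v, (v <= d)%N & a = grid v) /\
  (forall i a, (i <= n)%N -> E s i = Some a -> E s i.+1 <> Some a).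

Definition all_exposed (s : seq R) : Prop :=
  forall v : 'I_d.+1, exists i : 'I_n.+1, exposed (E s) (grid v) i.

(* Present a grid value that is nowhere next to an empty cell: it cannot be
   placed beside an equal value. *)
Lemma adversary m : (0 < n)%N -> (m <= n)%N ->
  (exists s, [/\ size s = m, all (@in01 R) s & spread s]) \/
  (exists s, [/\ (size s <= n)%N, all (@in01 R) s & all_exposed s]).
Proof.
move=> n_gt0; elim: m => [_|m IHm ltmn].
  left; exists [::]; split=> //; split.
    case=> [|j] a /=; first by case=> <-; exists 0%N => //; rewrite mul0r.
    by case: eqP => // _ [<-]; exists d => //; rewrite divff // pnatr_eq0 -lt0n.
  case=> [|j] a /= _.
    by case: eqP n_gt0 => [<-|].
  by case: eqP => // -> [<-]; case: eqP => // /eqP; rewrite gtn_eqF.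
have [[s [sm s01 [sgrid sprd]]]|] := IHm (ltnW ltmn); last by right.
have [/forallP allE|] := boolP [forall v : 'I_d.+1, [exists i : 'I_n.+1,
    exposed (E s) (grid v) i]].
  right; exists s; split=> //; first by rewrite sm ltnW.
  by move=> v; apply/existsP/allE.
rewrite negb_forall => /existsP[v]; rewrite negb_exists => /forallP hidden.
left; exists (rcons s (grid v)).
have v01 : in01 (grid v) by apply: grid01; rewrite -ltnS.
have [|ltn fresh] := @valg s (grid v) _ s01 v01; first by rewrite sm.
split; rewrite ?size_rcons ?sm ?all_rcons ?v01 //; split=> [i a|i a lein].
  rewrite bordered_rcons //; case: eqP => _; last exact: sgrid.
  by case=> <-; exists v; rewrite // -ltnS.
rewrite !bordered_rcons //.
have empty : E s (alg s (grid v)).+1 = None.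
  by rewrite /= (ltn_eqF ltn) /content (negPf fresh).
(* A neighbour of the new cell holding [grid v] would have exposed [grid v] at their common edge
   before the move. *)
have : ~~ exposed (E s) (grid v) i := hidden (Ordinal (n := n.+1) (m := i) lein).
rewrite /exposed eqSS; have [-> nexp [<-]|neqi] := eqVneq i (alg s (grid v)).+1.
  rewrite gtn_eqF // => Ei.
  by move: nexp; rewrite Ei empty !eqxx.
have [->|neqi1] := eqVneq i (alg s (grid v)); last by move=> _; exact: sprd.
by move=> nexp Ei [aE]; move: nexp; rewrite Ei empty aE !eqxx.
Qed.

Lemma cost_spread s : stream n s -> spread s -> n.+1%:R / d%:R <= cost n alg s.
Proof.
move=> strm [sgrid sprd]; rewrite /cost.
have -> : n.+1%:R / d%:R = \sum_(i < n.+1) d%:R^-1 :> R.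
  by rewrite sumr_const card_ord mulr_natl.
apply: ler_sum => i _.
have Ei := nth_final_seq valg strm (ltnW (ltn_ord i)).
have Ei1 := nth_final_seq valg strm (ltn_ord i).
have [v _ vE] := sgrid _ _ Ei; have [w _ wE] := sgrid _ _ Ei1.
have := sprd _ _ _ Ei; rewrite Ei1 vE wE -ltnS => /(_ (ltn_ord i)) neq.
rewrite -mulrBl normrM normfV normr_nat ler_peMl ?invr_ge0 //.
case: (ltngtP v w) => [vw|wv|eqvw]; last by case: neq; rewrite eqvw.
  by rewrite -natrB ?(ltnW vw) // normr_nat ler1n subn_gt0.
by rewrite distrC -natrB ?(ltnW wv) // normr_nat ler1n subn_gt0.
Qed.

(** Once the stream is completed with zeros, an edge that exposed [v] joins [v] to 0 and so costs
    [v]. *)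
Lemma bordered_cat0 s k i : (size s + k <= n)%N -> all (@in01 R) s ->
  E (s ++ nseq k 0) i = E s i \/
  E s i = None /\ E (s ++ nseq k 0) i = Some 0.
Proof.
elim: k s => [|k IHk] s szs s01; first by left; rewrite cats0.
have z01 : in01 (0 : R) by rewrite /in01 lexx ler01.
have ltsn : (size s < n)%N by rewrite (leq_trans _ szs) // addnS ltnS leq_addr.
have [lt fresh] := @valg s 0 ltsn s01 z01.
rewrite /= -cat_rcons.
have := IHk (rcons s 0); rewrite size_rcons addSnnS all_rcons z01.
move=> /(_ szs s01); rewrite bordered_rcons //.
have [->|//] := eqVneq i (alg s 0).+1.
have -> : E s (alg s 0).+1 = None.
  by rewrite /= /content (ltn_eqF lt) (negPf fresh).
by case=> [->|[]]; right.
Qed.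

Lemma cost_exposed s : (size s <= n)%N -> all (@in01 R) s -> all_exposed s ->
  exists t, stream n t /\ d.+1%:R / 2 <= cost n alg t.
Proof.
move=> szs s01 /fin_all_exists[f fE].
exists (s ++ nseq (n - size s) 0).
set t := _ ++ _; have strm : stream n t.
  split; first by rewrite size_cat size_nseq subnKC.
  by rewrite all_cat s01 all_nseq /in01 lexx ler01 orbT.
split=> //; have edgeE (v : 'I_d.+1) : grid v = edge t (f v).
  have Ei := nth_final_seq valg strm (ltnW (ltn_ord (f v))).
  have Ei1 := nth_final_seq valg strm (ltn_ord (f v)).
  have g0 : 0 <= grid v by rewrite divr_ge0.
  have szt : (size s + (n - size s) <= n)%N by rewrite subnKC.
  have := bordered_cat0 (f v) szt s01; have := bordered_cat0 (f v).+1 szt s01.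
  rewrite -/t Ei Ei1.
  move: _`_(f v).+1 _`_(f v) => b a.
  case/orP: (fE v) => /andP[/eqP-> /eqP->] -[] //.
  - by move=> [_ [->]] [[->]|[]//]; rewrite sub0r normrN ger0_norm.
  - by move=> [->] [//|[_ [->]]]; rewrite subr0 ger0_norm.
  - by case.
have finj : injective f.
  move=> v w fvw; have := fE w; rewrite -fvw => /(exposed_inj (fE v)).
  have dU : (d%:R^-1 : R) != 0 by rewrite invr_eq0 pnatr_eq0 -lt0n.
  by move=> /(mulIf dU)/eqP; rewrite eqr_nat => /eqP/val_inj.
have -> : d.+1%:R / 2 = \sum_(v < d.+1) grid v.
  rewrite -mulr_suml -natr_sum.
  apply: (mulIf (_ : d%:R != 0)); first by rewrite pnatr_eq0 -lt0n.
  rewrite mulfVK ?pnatr_eq0 -?lt0n //.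
  apply: (mulIf (_ : 2 != 0)); first by rewrite pnatr_eq0.
  rewrite mulrAC mulfVK ?pnatr_eq0 // -!natrM; congr _%:R.
  by rewrite -(big_mkord xpredT id) bin2_sum bin2 muln2 halfK oddM /= andNb subn0.
rewrite (eq_bigr _ (fun v _ => edgeE v)) /cost.
rewrite -(big_imset (fun i : 'I_n.+1 => edge t i) (in2W finj)) /=.
rewrite [leRHS](bigID (mem (f @: 'I_d.+1))) /= lerDl.
by apply: sumr_ge0 => i _.
Qed.

End LowerBound.

Lemma lower_bound (R : realType) (n : nat) (alg : online_alg R) :
  (0 < n)%N -> valid_alg n alg ->
  exists s : seq R, stream n s /\ Num.sqrt (n%:R / 2) <= cost n alg s.
Proof.
move=> n_gt0 valg; pose d := Num.truncn (Num.sqrt (2 * n%:R : R)).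
set y := Num.sqrt (n%:R / 2).
have n0 : 0 <= (n%:R : R) by [].
have n1 : 1 <= (n%:R : R) by rewrite ler1n.
have y0 : 0 <= y by rewrite sqrtr_ge0.
have yy : y ^+ 2 = n%:R / 2 by rewrite sqr_sqrtr // divr_ge0.
have xE : Num.sqrt (2 * n%:R : R) = 2 * y.
  apply/eqP; rewrite -(@eqrXn2 _ 2) ?sqrtr_ge0 ?mulr_ge0 //.
  by rewrite sqr_sqrtr ?mulr_ge0 // exprMn yy; apply/eqP; lra.
have y2 : 1 <= 2 * y by rewrite -(@ler_pXn2r _ 2) ?nnegrE ?mulr_ge0 // exprMn yy; lra.
(* Since [n = 2 y^2], the bound [d <= 2 y] gives [(n + 1) / d >= y] for a spread stream, and
   [2 y < d + 1] gives [(d + 1) / 2 >= y] for an exposed one. *)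
have /andP[led ltd] : d%:R <= 2 * y < d.+1%:R.
  by rewrite /d xE; apply: truncn_itv; rewrite mulr_ge0.
have d_gt0 : (0 < d)%N.
  rewrite lt0n; apply: contraTN ltd => /eqP->; rewrite -leNgt; lra.
have [[s [szs s01 sp]]|[s [szs s01 ex]]] := adversary valg d_gt0 n_gt0 (leqnn n).
  exists s; split=> //; apply: le_trans (cost_spread valg _ sp) => //.
  rewrite ler_pdivlMr ?ltr0n // -natr1.
  have : y * d%:R <= y * (2 * y) by rewrite ler_wpM2l.
  move: yy; rewrite expr2; lra.
have [t [st ct]] := cost_exposed valg d_gt0 szs s01 ex.
exists t; split=> //; apply: le_trans ct; lra.
Qed.

(** * The filling game *)

Section Game.
Variable R : realType.
Implicit Types (v w a b p x : R) (c d : seq (option R)) (s q : seq R).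

Local Notation filled := (pmap id).

Lemma in01_dist x a : in01 x -> in01 a -> `|x - a| <= 1.
Proof. by rewrite /in01 ler_norml => /andP[? ?] /andP[? ?]; lra. Qed.

Fixpoint variation a s : R :=
  if s is x :: s' then `|x - a| + variation x s' else 0.

Lemma variation_cat a s q :
  variation a (s ++ q) = variation a s + variation (last a s) q.
Proof. by elim: s a => [|x s IHs] a /=; rewrite ?add0r // IHs addrA. Qed.

Lemma variation_sum a s :
  variation a s = \sum_(i < size s) `|(a :: s)`_i.+1 - (a :: s)`_i|.
Proof.
by elim: s a => [|x s IHs] a; rewrite ?big_ord0 // big_ord_recl /= IHs.
Qed.

Lemma variation_le_size a s : in01 a -> all (@in01 R) s ->
  variation a s <= (size s)%:R.
Proof.
elim: s a => [|x s IHs] a //= a01 /andP[x01 s01].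
by rewrite -natr1 addrC lerD // ?IHs // in01_dist.
Qed.

Lemma full_array c : count_mem None c = 0%N -> c = map Some (filled c).
Proof. by elim: c => [|[x|] c IHc] //= c0; rewrite -IHc. Qed.

(* With [m] cells left to fill, the player can answer any stream so that the
   final array, read from left to right after an initial 0, varies by at most
   [v]. *)
Fixpoint winning v (m : nat) c : Prop :=
  if m is m'.+1 then
    forall x, in01 x -> exists c1 c2,
      c = c1 ++ None :: c2 /\ winning v m' (c1 ++ Some x :: c2)
  else exists s, [/\ c = map Some s, all (@in01 R) s & variation 0 s <= v].

Lemma winning_le v w m c : v <= w -> winning v m c -> winning w m c.
Proof.
move=> vw; elim: m c => [|m IHm] c /=.
  by case=> s [-> s01 sv]; exists s; split=> //; apply: le_trans vw.
move=> win x x01; have [c1 [c2 [-> win']]] := win x x01.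
by exists c1, c2; split=> //; apply: IHm.
Qed.

Lemma in0 : in01 (0 : R).
Proof. by rewrite /in01 lexx ler01. Qed.

(** Any empty cell will do, since each real differs from its predecessor by at most 1. This serves
    the short arrays at which the recursion ends. *)
Lemma winning_size m c : all (@in01 R) (filled c) -> count_mem None c = m ->
  winning (size c)%:R m c.
Proof.
elim: m c => [|m IHm] c c01 cm /=.
  exists (filled c); split; rewrite // -?full_array //.
  apply: le_trans (variation_le_size in0 c01) _.
  by rewrite ler_nat size_pmap count_size.
move=> x x01; have : None \in c by rewrite -has_pred1 has_count cm.
move=> /path.splitPr cE; case: cE c01 cm => c1 c2.
rewrite count_cat pmap_cat all_cat /= add1n addnS => /andP[c101 c201] [cm].
exists c1, c2; split=> //.
have -> : size (c1 ++ None :: c2) = size (c1 ++ Some x :: c2) by rewrite !size_cat.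
by apply: IHm; rewrite ?count_cat //= pmap_cat all_cat c101 /= x01.
Qed.

(** * Playing inside the holes of an array *)

Fixpoint fill c d : seq (option R) :=
  match c, d with
  | Some a :: c', _ => Some a :: fill c' d
  | None :: c', o :: d' => o :: fill c' d'
  | _, _ => c
  end.

Lemma fill_empty c : fill c (nseq (count_mem None c) None) = c.
Proof. by elim: c => [|[x|] c IHc] //=; rewrite IHc. Qed.

(** [c1] and [c2] do not depend on [o], so a move in [d] is a move in [fill c d]. *)
Lemma fill_cat c d1 d2 : (size d1 < count_mem None c)%N ->
  exists c1 c2, forall o, fill c (d1 ++ o :: d2) = c1 ++ o :: c2.
Proof.
elim: c d1 => [|[x|] c IHc] d1 //=.
  by move=> /IHc[c1 [c2 E]]; exists (Some x :: c1), c2 => o; rewrite E.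
case: d1 => [|o1 d1] /=; first by exists [::], (fill c d2).
by move=> /IHc[c1 [c2 E]]; exists (o1 :: c1), c2 => o; rewrite E.
Qed.

(* Number of maximal runs of empty cells; the flag tells whether the preceding
   cell is empty. *)
Fixpoint runs (gap : bool) c : nat :=
  match c with
  | Some _ :: c' => runs false c'
  | None :: c' => ~~ gap + runs true c'
  | [::] => 0
  end.

(* In the second bound the last filled cell holds [b], a value of [q], while
   [p] is the last value of [c]. *)
Lemma variation_fill_gen c q a b p :
  [/\ in01 a, in01 b & in01 p] -> all (@in01 R) (filled c) -> all (@in01 R) q ->
  size q = count_mem None c ->
  variation a (filled (fill c (map Some q)))
    <= variation a (filled c) + variation b q + 2 * (runs false c)%:R /\
  variation b (filled (fill c (map Some q)))
    <= variation p (filled c) + variation b q + 1 + 2 * (runs true c)%:R.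
Proof.
elim: c q a b p => [|[x|] c IHc] q a b p [a01 b01 p01] /=.
- by move=> _ _ /size0nil->; rewrite /= mulr0 !addr0 add0r ler01.
(* In the second bound, the 1 pays for the jump from [b] to [x] that ends a run of holes. *)
- case/andP=> x01 c01 q01 sq; have [|bound _] := IHc q x b p _ c01 q01 sq => //.
  have := in01_dist x01 b01; have : 0 <= `|x - p| by [].
  by move: bound; split; lra.
(* In the first bound a run begins here: the jump from [a] to [y] and the 1 that [bound1] reserves
   for leaving the run make up the 2 charged for it. *)
case: q => [|y q] //= c01 /andP[y01 q01] [sq].
have [|_ bound1] := IHc q a y a _ c01 q01 sq => //.
have [|_ bound2] := IHc q a y p _ c01 q01 sq => //.
rewrite natrD.
have := in01_dist y01 a01; have : 0 <= `|y - b| by [].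
by move: bound1 bound2; split; lra.
Qed.

Lemma filled_fill c d : count_mem None d = 0%N -> size d = count_mem None c ->
  count_mem None (fill c d) = 0%N.
Proof.
elim: c d => [|[x|] c IHc] d //= ; first exact: IHc.
by case: d => [|[y|] d] //= d0 [sd]; apply: IHc.
Qed.

Lemma filled_fill01 c q : all (@in01 R) (filled c) -> all (@in01 R) q ->
  all (@in01 R) (filled (fill c (map Some q))).
Proof.
elim: c q => [|[x|] c IHc] q //=.
  by move=> /andP[-> c01] q01; apply: IHc.
by case: q => [|y q] //= c01 /andP[-> q01]; apply: IHc.
Qed.

(* Filling the holes of [c] as if they were contiguous costs at most 2 more
   for each run of holes. *)
Lemma winning_fill v m c d : winning v m d -> size d = count_mem None c ->
  all (@in01 R) (filled c) ->
  winning (variation 0 (filled c) + v + 2 * (runs false c)%:R) m (fill c d).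
Proof.
move=> + + c01; elim: m d => [|m IHm] d /= win sd.
  case: win sd => q [-> q01 qv]; rewrite size_map => sq.
  exists (filled (fill c (map Some q))); split.
  - apply/full_array/filled_fill; rewrite ?size_map //.
    by rewrite count_map; elim: q {q01 qv sq}.
  - exact: filled_fill01.
  have [|bound _] := @variation_fill_gen c q 0 0 0 _ c01 q01 sq.
    by split; exact: in0.
  by apply: le_trans bound _; lra.
move=> x x01; have [d1 [d2 [dE win']]] := win x x01.
have lt : (size d1 < count_mem None c)%N.
  by rewrite -sd dE size_cat addnS ltnS leq_addr.
have [c1 [c2 E]] := fill_cat d2 lt.
exists c1, c2; rewrite dE -!E; split=> //; apply: IHm => //.
by rewrite -sd dE !size_cat.
Qed.

(* A block [(s, f)] consists of the values [s] followed by [f] empty cells. *)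
Definition array (bs : seq (seq R * nat)) : seq (option R) :=
  flatten [seq map Some e.1 ++ nseq e.2 None | e <- bs].

Lemma array_cat bs1 bs2 : array (bs1 ++ bs2) = array bs1 ++ array bs2.
Proof. by rewrite /array map_cat flatten_cat. Qed.

Lemma filled_array bs : filled (array bs) = flatten [seq e.1 | e <- bs].
Proof.
rewrite /array; elim: bs => [|[s f] bs IHbs] //=.
rewrite !pmap_cat IHbs; congr (_ ++ _).
have -> : filled (nseq f (None : option R)) = [::] by elim: f.
by rewrite cats0; elim: s => //= x s ->.
Qed.

Lemma count_array bs : count_mem None (array bs) = sumn [seq e.2 | e <- bs].
Proof.
rewrite /array; elim: bs => [|[s f] bs IHbs] //=.
rewrite !count_cat IHbs count_nseq /= mul1n; congr (_ + _)%N.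
by rewrite count_map; elim: s.
Qed.

(** The holes of a block are contiguous, so a block begins at most one run, whatever the flag at its
    start. *)
Lemma runs_array gap bs : (runs gap (array bs) <= count (fun e => 0 < e.2)%N bs)%N.
Proof.
have block g s f c : exists g',
    (runs g (map Some s ++ nseq f None ++ c) <= (0 < f) + runs g' c)%N.
  elim: s g => [|x s IHs] g /=; last exact: IHs.
  case: f => [|f] /=; first by exists g.
  exists true; have -> : runs true (nseq f None ++ c) = runs true c by elim: f.
  by rewrite leq_add2r; case: g.
elim: bs gap => [|[s f] bs IHbs] gap //=.
rewrite /array /= -catA; have [g' le] := block gap s f (array bs).
by apply: leq_trans le _; rewrite leq_add2l.
Qed.

(** * One phase of the block strategy *)

Section Phase.
Variables (h : nat) (lab : R -> nat) (delta w : R).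
Hypothesis delta0 : 0 <= delta.
Hypothesis w0 : 0 <= w.
Hypothesis lab_le : forall x, in01 x -> (lab x <= h)%N.
Hypothesis lab_close : forall x y, in01 x -> in01 y -> lab x = lab y ->
  `|x - y| <= delta.
Hypothesis recursive : forall m, (m <= h * h)%N -> winning w m (nseq m None).

Definition wf_block (e : seq R * nat) : bool :=
  [&& all (@in01 R) e.1, all (fun y => lab y == lab (head 0 e.1)) e.1
    & (e.2 <= h)%N].

Definition active (e : seq R * nat) : bool := (e.1 != [::]) && (0 < e.2)%N.

(** Its [uniq] is the invariant of the phase: at most one partially filled block for each label. *)
Definition active_labels (bs : seq (seq R * nat)) : seq nat :=
  [seq lab (head 0 e.1) | e <- bs & active e].

Lemma active_labels_cat bs1 bs2 :
  active_labels (bs1 ++ bs2) = active_labels bs1 ++ active_labels bs2.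
Proof. by rewrite /active_labels filter_cat map_cat. Qed.

Lemma active_labels_cons e bs :
  active_labels (e :: bs) =
    (if active e then [:: lab (head 0 e.1)] else [::]) ++ active_labels bs.
Proof. by rewrite /active_labels /=; case: ifP. Qed.

Lemma variation_block a s : in01 a -> all (@in01 R) s ->
  all (fun y => lab y == lab (head 0 s)) s ->
  variation a s <= 1 + (size s)%:R * delta.
Proof.
case: s => [|x s] a01 /=; first by rewrite mul0r addr0 ler01.
case/andP=> x01 s01 /andP[_ sl]; apply: lerD; first exact: in01_dist.
apply: (@le_trans _ _ ((size s)%:R * delta)); last first.
  by rewrite ler_wpM2r // ler_nat.
move lx: (lab x) sl => l sl.
elim: s x x01 lx s01 sl {a a01} => [|y s IHs] x x01 lx /=; first by rewrite mul0r.
case/andP=> y01 s01 /andP[/eqP ly sl].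
rewrite -natr1 mulrDl mul1r addrC lerD ?IHs //.
by rewrite lab_close // lx ly.
Qed.

Lemma variation_array a bs : in01 a -> all wf_block bs ->
  variation a (filled (array bs))
    <= (size bs)%:R + (size (filled (array bs)))%:R * delta.
Proof.
rewrite filled_array.
elim: bs a => [|[s f] bs IHbs] a a01 /=; first by rewrite mul0r addr0.
case/andP=> /and3P[/= s01 sl _] wfbs.
rewrite variation_cat size_cat natrD mulrDl -natr1.
have l01 : in01 (last a s).
  by case: s s01 {sl} => // x s sx; apply: (allP sx _ (mem_last x s)).
have := IHbs _ l01 wfbs; have := variation_block a01 s01 sl; lra.
Qed.

Lemma size_filled c : (size (filled c) <= size c)%N.
Proof. by rewrite size_pmap count_size. Qed.

Lemma filled_array01 bs : all wf_block bs -> all (@in01 R) (filled (array bs)).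
Proof.
move=> wfbs; rewrite filled_array; apply/allP => x /flatten_mapP[e].
by move=> /(allP wfbs)/and3P[e01 _ _] /(allP e01).
Qed.

(** One jump into each block, [delta] for each cell, 2 for each of at most [h] runs of holes at the
    restart, and [w] for the restarted game. *)
Definition phase_cost (bs : seq (seq R * nat)) : R :=
  (size bs)%:R + (size (array bs))%:R * delta + 2 * h%:R + w.

Lemma variation_array_le bs : all wf_block bs ->
  variation 0 (filled (array bs)) + 2 * h%:R + w <= phase_cost bs.
Proof.
move=> wfbs; rewrite /phase_cost !lerD2r.
apply: le_trans (variation_array in0 wfbs) _.
by rewrite lerD2l ler_wpM2r // ler_nat size_filled.
Qed.

(** The active labels and [lab x] are distinct elements of [0..h], so at most [h] blocks are active.
    No untouched block has room, so all holes lie in active blocks: at most [h * h] holes in at most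
    [h] runs, and [recursive] applies to them. *)
Lemma winning_stuck bs x : in01 x -> all wf_block bs -> uniq (active_labels bs) ->
  lab x \notin active_labels bs ->
  all (fun e => (0 < e.2)%N ==> (e.1 != [::])) bs ->
  winning (phase_cost bs) (count_mem None (array bs)) (array bs).
Proof.
move=> x01 wfbs ubs xbs nofresh.
have actE : count (fun e => 0 < e.2)%N bs = size (active_labels bs).
  rewrite size_map size_filter; apply: eq_in_count => e /(allP nofresh).
  by rewrite /active; case: (0 < e.2)%N => /=; rewrite ?andbF // => ->.
have le_act : (size (active_labels bs) <= h)%N.
  rewrite -ltnS -[(size _).+1]/(size (lab x :: active_labels bs)).
  rewrite -[X in (_ <= X)%N](size_iota 0); apply: uniq_leq_size.
    by rewrite /= xbs.
  move=> l; rewrite inE mem_iota add0n ltnS => /predU1P[->|]; first exact: lab_le.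
  case/mapP=> -[s f]; rewrite mem_filter => /andP[/andP[/= s0 _]].
  move/(allP wfbs) => /and3P[/= s01 _ _] ->; apply: lab_le.
  by case: s s0 s01 => //= y s _ /andP[].
have le_hh : (count_mem None (array bs) <= h * h)%N.
  rewrite count_array; apply: (@leq_trans (h * count (fun e => 0 < e.2)%N bs)).
    elim: bs {ubs xbs nofresh actE le_act} wfbs => //= e bs IHbs.
    case/andP=> /and3P[_ _ eh] /IHbs le; rewrite mulnDr leq_add //.
    by case: (e.2) eh => //= f; rewrite muln1.
  by rewrite actE leq_mul2l le_act orbT.
have := winning_fill (recursive le_hh) (size_nseq _ _) (filled_array01 wfbs).
rewrite fill_empty; apply: winning_le; apply: le_trans (variation_array_le wfbs).
rewrite addrAC lerD2r lerD2l ler_wpM2l // ler_nat.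
by apply: leq_trans (runs_array _ _) _; rewrite actE.
Qed.

Lemma winning_phase m bs : all wf_block bs -> uniq (active_labels bs) ->
  count_mem None (array bs) = m -> winning (phase_cost bs) m (array bs).
Proof.
elim: m bs => [|m IHm] bs wfbs ubs bm.
  exists (filled (array bs)); split; [exact: full_array|exact: filled_array01|].
  apply: le_trans (variation_array_le wfbs).
  by rewrite -addrA lerDl addr_ge0 // mulr_ge0.
move=> x x01.
(* Covers both kinds of move: continuing a reserved block, and opening an untouched one with [s]
   empty. *)
have place bs1 s f bs2 : bs = bs1 ++ (s, f.+1) :: bs2 ->
    all (fun y => lab y == lab x) s -> lab x \notin active_labels (bs1 ++ bs2) ->
    uniq (active_labels (bs1 ++ bs2)) ->
    exists c1 c2, array bs = c1 ++ None :: c2 /\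
      winning (phase_cost bs) m (c1 ++ Some x :: c2).
  move=> bsE sx xact uact; pose bs' := bs1 ++ (rcons s x, f) :: bs2.
  exists (array bs1 ++ map Some s), (nseq f None ++ array bs2).
  have arrE : array bs = (array bs1 ++ map Some s) ++ None :: nseq f None ++ array bs2.
    by rewrite bsE array_cat /array /= -!catA.
  have arrE' : array bs' = (array bs1 ++ map Some s) ++ Some x :: nseq f None ++ array bs2.
    by rewrite /bs' array_cat /array /= -!catA map_rcons -cats1 -!catA.
  split=> //; rewrite -arrE'.
  (* A move preserves the number of blocks and the number of cells. *)
  have -> : phase_cost bs = phase_cost bs'.
    by rewrite /phase_cost arrE arrE' bsE !size_cat.
  apply: IHm.
  - move: wfbs; rewrite bsE /bs' !all_cat /= => /and3P[-> we ->]; rewrite andbT.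
    move: we; rewrite /wf_block /= !all_rcons x01 => /and3P[-> _ /ltnW->].
    case: s sx {bsE bs' arrE arrE'} => [|y s] /=; first by rewrite eqxx.
    case/andP=> /eqP yx sx; rewrite yx !eqxx /=; rewrite andbT.
    exact: sx.
  - have head_lab : lab (head 0 (rcons s x)) = lab x.
      by case: s sx {bsE bs' arrE arrE'} => [|y s] //= /andP[/eqP].
    rewrite /bs' active_labels_cat active_labels_cons uniq_catCA head_lab.
    rewrite -active_labels_cat; case: ifP => //= _; by rewrite xact.
  move: bm; rewrite arrE arrE' !count_cat /=; lia.
have [/mapP[[s f]]|xact] := boolP (lab x \in active_labels bs).
  rewrite mem_filter => /andP[/andP[/= s0 f0]] /path.splitPr sE xs.
  case: sE place wfbs ubs {bm IHm} => bs1 bs2 place wfbs ubs.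
  case: f f0 place wfbs ubs => // f _ place wfbs ubs.
  apply: (place bs1 s f bs2) => //.
  - rewrite xs; move: wfbs; rewrite all_cat /= => /and3P[_ /and3P[]] //.
  - move: ubs; rewrite (active_labels_cat bs1 (_ :: _)) active_labels_cons uniq_catCA.
    by rewrite /active s0 /= -xs active_labels_cat => /andP[].
  - move: ubs; rewrite (active_labels_cat bs1 (_ :: _)) active_labels_cons uniq_catCA.
    by rewrite /active s0 /= active_labels_cat => /andP[].
(* No block reserved for [lab x] has room: restart, unless an untouched block remains to be
   opened. *)
have [nofresh|] := boolP (all (fun e => (0 < e.2)%N ==> (e.1 != [::])) bs).
  by have := winning_stuck x01 wfbs ubs xact nofresh; rewrite bm; apply.
case/allPn=> -[s f] /path.splitPr sE; rewrite negb_imply negbK /= => /andP[f0 /eqP s0].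
case: sE place ubs xact {bm IHm wfbs} => bs1 bs2; rewrite s0.
case: f f0 => // f _ place.
rewrite active_labels_cat active_labels_cons /active /= -active_labels_cat => ubs xact.
exact: (place bs1 [::] f bs2).
Qed.

End Phase.
End Game.

(** * Upper bound: recursion and extraction of the algorithm *)

Section UpperBound.
Variable R : realType.
Implicit Types (v x : R) (c : seq (option R)) (s : seq R).

Lemma array_nseq q h : array (nseq q ([::] : seq R, h)) = nseq (q * h) None.
Proof. by elim: q => //= q IHq; rewrite mulSn nseqD -IHq. Qed.

Lemma truncn_close (h : nat) x y : (0 < h)%N -> in01 x -> in01 y ->
  Num.truncn (h%:R * x) = Num.truncn (h%:R * y) -> `|x - y| <= h%:R^-1.
Proof.
move=> h_gt0 /andP[x0 _] /andP[y0 _].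
have /truncn_itv : 0 <= h%:R * x by rewrite mulr_ge0.
have /truncn_itv : 0 <= h%:R * y by rewrite mulr_ge0.
move=> /[swap] + + xy; rewrite xy => /andP[x1 x2] /andP[y1 y2].
rewrite -[_^-1]mul1r ler_pdivlMr ?ltr0n // -[h%:R in leLHS]normr_nat -normrM.
rewrite -natr1 in x2 y2; rewrite ler_norml; apply/andP; split; lra.
Qed.

(* With [h] about [sqrt r / 2], a phase uses [h + 1] labels and blocks of [h]
   cells, and leaves at most [h * h <= r / 4] cells to the next phase. *)
Lemma winning_sqrt r : winning (16 * Num.sqrt (r%:R : R)) r (nseq r None).
Proof.
elim/ltn_ind: r => r IHr; set y := Num.sqrt _.
have y0 : 0 <= y by rewrite sqrtr_ge0.
have yy : y * y = r%:R by rewrite -expr2 sqr_sqrtr.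
(* For [y < 8] the trivial bound [r = y * y] is already below [16 y]. *)
have [y8|y8] := ltP y 8.
  apply: (@winning_le _ r%:R).
    by rewrite -yy; apply: ler_wpM2r => //; lra.
  rewrite -[X in X%:R](size_nseq r (None : option R)); apply: winning_size.
    by elim: r {IHr y y0 yy y8}.
  by rewrite count_nseq /= mul1n.
have [h /andP[hle]] : exists h, h%:R <= y / 2 < h.+1%:R.
  by exists (Num.truncn (y / 2)); apply: truncn_itv; lra.
rewrite -(natr1 h) => hgt.
have h_gt0 : 0 < h%:R :> R by lra.
have h_gt0' : (0 < h)%N by rewrite -(ltr_nat R).
have hh_lt : (h * h < r)%N by rewrite -(ltr_nat R) natrM -yy; apply: ltr_pM => //; lra.
(* The last block takes the [r %% h] remaining cells, possibly none. *)
pose bs : seq (seq R * nat) := nseq (r %/ h) ([::], h) ++ [:: ([::], r %% h)]%N.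
have arrE : array bs = nseq r None.
  rewrite /bs array_cat array_nseq [array [:: _]]cats0 -nseqD.
  by rewrite -divn_eq.
rewrite -arrE; apply: (@winning_le _ (phase_cost h h%:R^-1 (16 * h%:R) bs)).
  (* As [y >= 8], [h > y / 2 - 1 >= 3 y / 8], so [r / h <= 8 y / 3]. The blocks cost at most
     [8 y / 3 + 1], the cells [8 y / 3], the runs [y] and the restart [8 y]: together at most
     [16 y]. *)
  rewrite /phase_cost arrE size_nseq size_cat size_nseq /= natrD.
  have rh : r%:R * h%:R^-1 <= 8 / 3 * y.
    by rewrite ler_pdivrMr // -yy mulrAC ler_wpM2r //; lra.
  have : (r %/ h)%:R <= r%:R * h%:R^-1 :> R.
    by rewrite ler_pdivlMr // -natrM ler_nat leq_trunc_div.
  lra.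
apply: (@winning_phase _ h (fun x => Num.truncn (h%:R * x))).
- by rewrite invr_ge0.
- by rewrite mulr_ge0.
- move=> x /andP[x0 x1]; rewrite -(ler_nat R).
  have /truncn_itv/andP[le _] : 0 <= h%:R * x by rewrite mulr_ge0.
  by apply: le_trans le _; rewrite ler_piMr.
- by move=> x z x01 z01; apply: truncn_close.
- move=> m mhh; apply: winning_le (IHr _ (leq_ltn_trans mhh hh_lt)).
  rewrite ler_wpM2l // -[leRHS]ger0_norm // -sqrtr_sqr ler_wsqrtr //.
  by rewrite -natrX ler_nat expnS expn1.
- rewrite all_cat all_nseq /wf_block /= leqnn orbT /=.
  by rewrite andbT ltnW // ltn_mod.
- rewrite active_labels_cat /active_labels; by elim: (r %/ h)%N.
by rewrite arrE count_nseq /= mul1n.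
Qed.

Lemma set_nth_mid c1 c2 (o o' : option R) :
  set_nth None (c1 ++ o :: c2) (size c1) o' = c1 ++ o' :: c2.
Proof. by elim: c1 => //= a c1 ->. Qed.

(** Choice turns winning moves into a function [f], and the algorithm replays the prefix to recover
    the current array. The extra 1 pays for the last jump, to the sentinel 1. *)
Lemma strategy n v : winning v n (nseq n None) ->
  exists alg : online_alg R, valid_alg n alg /\
    forall s, stream n s -> cost n alg s <= v + 1.
Proof.
move=> win0.
(* The hypotheses sit inside [good] so that a choice exists for every pair; off winning positions
   the index 0 serves as a dummy. *)
pose good (p : seq (option R) * R) j :=
  (0 < count_mem None p.1)%N -> in01 p.2 -> winning v (count_mem None p.1) p.1 ->
  let c := set_nth None p.1 j (Some p.2) in
  [/\ (j < size p.1)%N, nth None p.1 j = None,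
      count_mem None c = (count_mem None p.1).-1
    & winning v (count_mem None p.1).-1 c].
have /choice[f fP] : forall p, exists j, good p j.
  case=> c x; rewrite /good /=; case cE: (count_mem None c) => [|m].
    by exists 0%N.
  have [x01|nx01] := boolP (in01 x); last by exists 0%N.
  have [win|nwin] := pselect (winning v m.+1 c); last by exists 0%N.
  have [c1 [c2 [c12 win']]] := win x x01.
  exists (size c1) => _ _ _; rewrite c12 set_nth_mid; split=> //.
  - by rewrite size_cat addnS ltnS leq_addr.
  - by rewrite nth_cat ltnn subnn.
  by move: cE; rewrite c12 !count_cat /= add1n addnS => -[].
pose cfg s := foldl (fun c y => set_nth None c (f (c, y)) (Some y)) (nseq n None) s.
pose alg : online_alg R := fun s x => f (cfg s, x).
have inv s : (size s <= n)%N -> all (@in01 R) s ->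
    [/\ size (cfg s) = n, count_mem None (cfg s) = (n - size s)%N,
        winning v (n - size s) (cfg s)
      & forall j, (j < n)%N -> nth None (cfg s) j = content alg s j].
  elim/last_ind: s => [_ _|s x IHs].
    rewrite subn0 /cfg /= size_nseq count_nseq mul1n; split=> // j ltjn.
    by rewrite nth_nseq ltjn.
  rewrite size_rcons all_rcons => ltsn /andP[x01 s01].
  have [sz ct win nthE] := IHs (ltnW ltsn) s01.
  have := fP (cfg s, x); rewrite /good /= ct subn_gt0 => /(_ ltsn x01 win).
  rewrite sz -subnS /cfg foldl_rcons -/(cfg s) => -[lt none ct' win'].
  split=> //; first by rewrite size_set_nth sz; apply/maxn_idPr.
  move=> j ltjn; rewrite nth_set_nth /= content_rcons ?nthE //.
  by apply/negP => algp; move: none; rewrite nthE // /content /alg algp.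
exists alg.
have valg : valid_alg n alg.
  move=> s x ltsn s01 x01.
  have [sz ct win nthE] := inv s (ltnW ltsn) s01.
  have := fP (cfg s, x); rewrite /good /= ct subn_gt0 => /(_ ltsn x01 win).
  rewrite sz => -[lt none _ _]; split=> //.
  by apply/negP => algp; move: none; rewrite nthE // /content algp.
split=> // s strm; have [szs s01] := strm.
have := inv s; rewrite szs subnn leqnn => /(_ isT s01)[sz _ [q [qE q01 qv]] nthE].
have cellsE : [seq cell alg s j | j <- iota 0 n] = q.
  have szq : size q = n by rewrite -sz qE size_map.
  apply: (@eq_from_nth _ 0); rewrite size_map size_iota // => j ltjn.
  rewrite (nth_map 0%N) ?size_iota // nth_iota // add0n.
  have := nthE j ltjn; rewrite qE (nth_map 0) ?szq // /content.
  by rewrite (full_placements valg strm ltjn) => -[].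
have szq : size (rcons q 1) = n.+1 by rewrite size_rcons -cellsE size_map size_iota.
have -> : cost n alg s = variation 0 (rcons q 1).
  by rewrite variation_sum szq /cost /final_seq cellsE.
rewrite -cats1 variation_cat /= addr0 lerD //.
apply: in01_dist; first by rewrite /in01 ler01 lexx.
case: q {qE cellsE szq qv} q01 => [_|x q q01] /=; first exact: in0.
exact: (allP q01 _ (mem_last x q)).
Qed.

End UpperBound.

Theorem theorem3 (R : realType) (n : nat) (hn : (0 < n)%N) :
  (exists alg : online_alg R, valid_alg n alg /\
     forall s : seq R, stream n s -> cost n alg s <= 18 * Num.sqrt (n%:R))
  /\
  (forall alg : online_alg R, valid_alg n alg ->
     exists s : seq R, stream n s /\ Num.sqrt (n%:R / 2) <= cost n alg s).
Proof.
split; last by move=> alg; exact: lower_bound.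
have [alg [valg algP]] := strategy (winning_sqrt R n).
exists alg; split=> // s /algP le; apply: le_trans le _.
(* This absorbs the extra 1: [16 sqrt n + 1 <= 18 sqrt n]. *)
have : 1 <= Num.sqrt (n%:R : R) by rewrite -[leLHS]sqrtr1 ler_wsqrtr // ler1n.
lra.
Qed.
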